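(* Let $f_1,\dots,f_m:\mathbb{R}^n\to\mathbb{R}$ be convex and aligned, and suppose the set $C_\star$ of common minimizers is bounded. Run the MG-AMOO algorithm for $K$ iterations with SOO an online learning algorithm, producing $\mathbf{x}_1,\dots,\mathbf{x}_K$ and $\bar{\mathbf{x}}=\frac1K\sum_{k=1}^K\mathbf{x}_k$. Let $\mathcal{X}$ be the convex hull of $\{\mathbf{x}_1,\dots,\mathbf{x}_K\}\cup C_\star$, suppose that every $f_i$ is bounded on $\mathcal{X}$, and that the online learning algorithm has regret at most $\mathrm{Regret}(K)$ against adaptive adversaries over $\mathcal{X}$. Then $$\mathrm{MG}(\bar{\mathbf{x}})\le\frac{\mathrm{Regret}(K)}{K}.$$
   Context: Each $f_i$ attains its minimum $f_i^\star=\min_{\mathbf{x}\in\mathbb{R}^n}f_i(\mathbf{x})$. Aligned means that $C_\star=\{\mathbf{x}\in\mathbb{R}^n: f_i(\mathbf{x})=f_i^\star\ \forall i\in[m]\}$ is non-empty. $\mathrm{MG}(\mathbf{x})=\max_{i\in[m]}\big(f_i(\mathbf{x})-f_i^\star\big)$. MG-AMOO algorithm (knows $f_1^\star,\dots,f_m^\star$): for $k=1,\dots,K$, choose $I(k)\in\arg\max_{i\in[m]}\big(f_i(\mathbf{x}_k)-f_i^\star\big)$ and set $\mathbf{x}_{k+1}=\mathrm{SOO}(f_{I(k)},\mathbf{x}_k)$. Output $\bar{\mathbf{x}}=\frac1K\sum_{k=1}^K\mathbf{x}_k$. An online learning algorithm produces each $\mathbf{x}_{k+1}$ from the previously revealed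 functions and iterates. It has regret at most $\mathrm{Regret}(K)$ (with $\mathrm{Regret}(K)\in o(K)$) against adaptive adversaries over a bounded convex set $\mathcal{X}$ if, for every sequence $g_1,\dots,g_K$ of convex functions bounded on $\mathcal{X}$, where $g_k$ may be chosen depending on $\mathbf{x}_1,\dots,\mathbf{x}_k$, and for every $\mathbf{x}\in\mathcal{X}$, $\sum_{k=1}^K g_k(\mathbf{x}_k)-\sum_{k=1}^K g_k(\mathbf{x})\le\mathrm{Regret}(K)$. *)

(* Defs.v *)
From HB Require Import structures.
From mathcomp Require Export all_boot all_order all_algebra.
From mathcomp Require Export all_classical all_reals all_analysis.

Set Implicit Arguments.
Unset Strict Implicit.
Unset Printing Implicit Defensive.

Export Order.TTheory GRing.Theory Num.Theory.
Export numFieldNormedType.Exports.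

#[global] Open Scope classical_set_scope.
#[global] Open Scope ring_scope.

Definition convex_hull (R : numDomainType) (M : lmodType R) (A : set M) : set M :=
  smallest (@convex_set R M) A.

Definition is_minimum (R : realType) (T : Type) (g : T -> R) (a : R) : Prop :=
  (exists x, g x = a) /\ (forall x, a <= g x).

Section Objectives.
Variables (R : realType) (n m : nat).
Variables (f : 'I_m -> 'rV[R]_n -> R) (fstar : 'I_m -> R).

Definition common_minimizers : set 'rV[R]_n :=
  [set x | forall i, f i x = fstar i].

(* The default value 0 of the iterated maximum does not affect it when
   [fstar i] is the minimum of [f i] and [0 < m]: all the gaps are
   nonnegative. *)
Definition max_gap (x : 'rV[R]_n) : R :=
  \big[Num.max/0]_(i < m) (f i x - fstar i).

Definition is_argmax_gap (x : 'rV[R]_n) (i : 'I_m) : Prop :=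
  forall j, f j x - fstar j <= f i x - fstar i.

End Objectives.

(* Rounds are numbered from 0: [x k] and [g k] are the iterate and the function
   of round k+1 in the usual 1-based numbering, and K rounds are k < K. *)
Section OnlineLearning.
Variables (R : realType) (n : nat).

(* An online learning algorithm maps the history of the past rounds (oldest
   first), each consisting of an iterate and the function revealed after it, to
   the next iterate; its value on the empty history is the first iterate. *)
Definition online_algorithm : Type :=
  seq ('rV[R]_n * ('rV[R]_n -> R)) -> 'rV[R]_n.

Definition iterates_of (A : online_algorithm) (g : nat -> 'rV[R]_n -> R)
    (K : nat) (x : nat -> 'rV[R]_n) : Prop :=
  forall k, (k < K)%N -> x k = A (mkseq (fun j => (x j, g j)) k).

(* An adaptive adversary maps the iterates up to and including the current one
   to the function revealed in the current round. *)
Definition adaptive_adversary : Type := seq 'rV[R]_n -> 'rV[R]_n -> R.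

(* The functions of the adversary are convex and bounded on [X] by a common
   constant [B]. The bound has to be common: with a separate unrestricted bound
   for each function, rescaling the first revealed function would make the
   regret over [X] arbitrarily large unless [X] is included in the singleton of
   the first iterate. *)
Definition regret_at_most (A : online_algorithm) (X : set 'rV[R]_n) (B : R)
    (K : nat) (r : R) : Prop :=
  forall (G : adaptive_adversary) (x : nat -> 'rV[R]_n),
    (forall s, convex_function [set: 'rV[R]_n] (G s)) ->
    (forall s y, X y -> `|G s y| <= B) ->
    let g k := G (mkseq x k.+1) in
    iterates_of A g K x ->
    forall y, X y -> \sum_(k < K) g k (x k) - \sum_(k < K) g k y <= r.

End OnlineLearning.

Definition mg_amoo_run (R : realType) (n m : nat)
    (f : 'I_m -> 'rV[R]_n -> R) (fstar : 'I_m -> R) (A : online_algorithm R n)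
    (K : nat) (I : nat -> 'I_m) (x : nat -> 'rV[R]_n) : Prop :=
  (forall k, (k < K)%N -> is_argmax_gap f fstar (x k) (I k)) /\
  iterates_of A (fun k => f (I k)) K x.

(* Main.v *)
(* Let the adversary reveal [f (I k)] in round k. Comparing with a common
   minimizer [y], where [f (I k) y = fstar (I k)], the regret of the run is the
   sum over k of the maximal gap at [x k], hence bounds the sum of the gaps of
   each [f i]; Jensen's inequality transfers this to the averaged iterate. *)
Require Import Defs.

Set Implicit Arguments.
Unset Strict Implicit.
Unset Printing Implicit Defensive.

(** Jensen's inequality with uniform weights, by induction: the mean of K+2 points is the convex
    combination of the last point, with weight 1/(K+2), and the mean of the first K+1. *)
Lemma convex_function_mean (R : numFieldType) (E : lmodType R) (f : E -> R)
    (x : nat -> E) (K : nat) :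
  convex_function [set: E] f -> (0 < K)%N ->
  f (K%:R^-1 *: \sum_(k < K) x k) <= K%:R^-1 * \sum_(k < K) f (x k).
Proof.
move=> cf; case: K => // K _; elim: K => [|K IHK].
  by rewrite !big_ord_recl !big_ord0 !addr0 invr1 scale1r mul1r.
pose t : R := K.+2%:R^-1.
have t0 : 0 <= t by rewrite invr_ge0.
have t1 : t <= 1 by rewrite invf_le1 ?ltr0n// ler1n.
(* Scaled by [1 - t], the old weights 1/(K+1) become the new weights [t]. *)
have tE : (1 - t) * K.+1%:R^-1 = t.
  have <- : t * K.+1%:R = 1 - t.
    apply/eqP; rewrite eq_sym subr_eq -{2}[t]mulr1 -mulrDr natr1.
    by rewrite mulVf// pnatr_eq0.
  by rewrite mulfK// pnatr_eq0.
rewrite ![\sum_(k < K.+2) _]big_ord_recr/= -/t -{1}tE.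
rewrite [_ + x _]addrC scalerDr tE -{2}tE -scalerA.
set y := K.+1%:R^-1 *: _.
have cfty : f (t *: x K.+1 + (1 - t) *: y) <= t * f (x K.+1) + (1 - t) * f y.
  exact: (cf (Itv01 t0 t1) _ _ (in_setT _) (in_setT _)).
apply: (le_trans cfty); rewrite mulrDr addrC lerD2r -{2}tE -mulrA.
by rewrite ler_wpM2l// subr_ge0.
Qed.

Theorem corollary1 (R : realType) (n m K : nat)
    (f : 'I_m -> 'rV[R]_n -> R) (fstar : 'I_m -> R)
    (SOO : online_algorithm R n) (I : nat -> 'I_m) (x : nat -> 'rV[R]_n)
    (B : R) (Regret : nat -> R) :
  (0 < m)%N -> (0 < K)%N ->
  (forall i, convex_function [set: 'rV[R]_n] (f i)) ->
  (forall i, is_minimum (f i) (fstar i)) ->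
  common_minimizers f fstar !=set0 ->
  bounded_set (common_minimizers f fstar) ->
  mg_amoo_run f fstar SOO K I x ->
  let xbar := K%:R^-1 *: \sum_(k < K) x k in
  let X := convex_hull
    ([set x k | k in [set k | (k < K)%N]] `|` common_minimizers f fstar) in
  (forall i y, X y -> `|f i y| <= B) ->
  (Regret : nat -> R^o) =o_\oo (fun k => k%:R : R^o) ->
  regret_at_most SOO X B K (Regret K) ->
  max_gap f fstar xbar <= Regret K / K%:R.
Proof.
move=> m0 K0 cf fmin [y ymin] _ [argmaxI runx] xbar X fB _ regretK.
have Xy : X y by apply: sub_gen_smallest; right.
(* The choices [I] of the run are already fixed, so the adversary only needs the round number. In
   round k it sees k+1 iterates, hence the predecessor. Every value of [G] is some [f i], hence
   convex and bounded by [B] on [X]. *)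
pose G (s : seq 'rV[R]_n) := f (I (size s).-1).
have GE k : G (mkseq x k.+1) = f (I k) by rewrite /G size_mkseq.
have runG : iterates_of SOO (fun k => G (mkseq x k.+1)) K x.
  by rewrite (_ : (fun k => _) = fun k => f (I k)) //; apply/funext => k.
have regret_le := regretK G x (fun s => cf _) (fun s => fB _) runG y Xy.
have gap_le i : f i xbar - fstar i <= Regret K / K%:R.
  rewrite mulrC lerBlDr.
  (* With [fstar i] written as a mean, the gap bound reduces to a termwise comparison of sums. *)
  have -> : fstar i = K%:R^-1 * \sum_(k < K) fstar i.
    rewrite sumr_const card_ord -[fstar i *+ K]mulr_natl mulKf//.
    by rewrite pnatr_eq0 -lt0n.
  rewrite -mulrDr; apply: le_trans (convex_function_mean x (cf i) K0) _.
  rewrite ler_wpM2l ?invr_ge0// -lerBlDr; apply: le_trans regret_le.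
  rewrite -!sumrB; apply: ler_sum => k _.
  by rewrite GE ymin; exact: argmaxI.
apply: bigmax_le => //.
(* The default 0 of the maximum is below the bound because some gap is, and gaps are nonnegative;
   this is where [0 < m] enters. *)
by rewrite (le_trans _ (gap_le (Ordinal m0)))// subr_ge0 (fmin _).2.
Qed.
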